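(* Let $E$ be a nonzero reflexive real Banach space, let $f,g\colon E\times E^*\to\,]{-}\infty,\infty]$ be proper convex lower semicontinuous BC--functions such that $\bigcup_{\lambda>0}\lambda[\pi_1\mathrm{dom}\,f-\pi_1\mathrm{dom}\,g]$ is a closed linear subspace of $E$, and for $(x,x^* )\in E\times E^*$ let $h(x,x^* ):=\inf\{f(x,s^* )+g(x,t^* )\colon s^*,t^*\in E^*,\ s^*+t^*=x^*\}$. Then $h$ is a BC--function, ${\cal P}_q(h^@)=\{(x,s^*+t^* )\colon (x,s^* )\in{\cal P}_q(f^@),\ (x,t^* )\in{\cal P}_q(g^@)\}$, and ${\cal P}_q(h)=\{(x,s^*+t^* )\colon (x,s^* )\in{\cal P}_q(f),\ (x,t^* )\in{\cal P}_q(g)\}$.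
   Context: $\pi_1(x,x^* ):=x$; $\mathrm{dom}\,f:=\{(x,x^* )\colon f(x,x^* )\in\mathbb{R}\}$. On $E\times E^*$ set $\lfloor(x,x^* ),(y,y^* )\rfloor:=\langle x,y^*\rangle+\langle y,x^*\rangle$ and $q(x,x^* ):=\langle x,x^*\rangle$. For a function $k$ on $E\times E^*$, $k^@(y,y^* ):=\sup_{(x,x^* )}[\lfloor(x,x^* ),(y,y^* )\rfloor-k(x,x^* )]$; a BC--function is a proper convex $k$ with $k^@\ge k\ge q$ on $E\times E^*$; for $k\ge q$, ${\cal P}_q(k):=\{(x,x^* )\colon k(x,x^* )=\langle x,x^*\rangle\}$. *)

(* Defs.v *)
From HB Require Import structures.
From mathcomp Require Import all_boot all_order all_algebra.
From mathcomp Require Import all_classical all_reals all_analysis.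
Set Implicit Arguments. Unset Strict Implicit. Unset Printing Implicit Defensive.
Import Order.TTheory GRing.Theory Num.Theory.
Import numFieldNormedType.Exports.
Local Open Scope classical_set_scope.
Local Open Scope ring_scope.

Section BC.
Variables (R : realType) (E : completeNormedModType R).

(* E^ * : the continuous linear functionals on E (represented as functions
   E -> R satisfying is_dual). *)
Definition is_dual (u : E -> R) : Prop :=
  (forall (a : R) (x y : E), u (a *: x + y) = a * u x + u y) /\ continuous u.

Definition opnorm (u : E -> R) : \bar R :=
  ereal_sup [set (`|u x|)%:E | x in [set x : E | `|x| <= 1]].

Definition reflexive_space : Prop :=
  forall phi : (E -> R) -> R,
    (forall (a : R) (u v : E -> R), is_dual u -> is_dual v ->
        phi (fun z => a * u z + v z) = a * phi u + phi v) ->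
    (exists C : R, forall u, is_dual u -> ((`|phi u|)%:E <= C%:E * opnorm u)%E) ->
    exists x : E, forall u, is_dual u -> phi u = u x.

Definition proper_fun (F : E -> (E -> R) -> \bar R) : Prop :=
  (exists x u, is_dual u /\ (F x u < +oo)%E) /\
  (forall x u, is_dual u -> F x u <> -oo%E).

Definition convex_fun (F : E -> (E -> R) -> \bar R) : Prop :=
  forall x u y v (l : R), is_dual u -> is_dual v -> 0 < l < 1 ->
    (F (l *: x + (1 - l) *: y)%R (fun z => l * u z + (1 - l) * v z)%R
      <= l%:E * F x u + (1 - l)%R%:E * F y v)%E.

Definition lsc (F : E -> (E -> R) -> \bar R) : Prop :=
  forall x u, is_dual u -> forall r : R, (r%:E < F x u)%E ->
    exists2 d : R, 0 < d & forall y v, is_dual v -> `|y - x| < d ->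
      (opnorm (fun z => v z - u z)%R < d%:E)%E -> (r%:E < F y v)%E.

Definition q (x : E) (u : E -> R) : \bar R := (u x)%:E.

Definition bpair (x : E) (u : E -> R) (y : E) (v : E -> R) : R := v x + u y.

Definition conjat (k : E -> (E -> R) -> \bar R) (y : E) (v : E -> R) : \bar R :=
  ereal_sup [set z | exists x u, is_dual u /\ z = ((bpair x u y v)%:E - k x u)%E].

Definition BC (k : E -> (E -> R) -> \bar R) : Prop :=
  proper_fun k /\ convex_fun k /\
  (forall x u, is_dual u -> (q x u <= k x u)%E /\ (k x u <= conjat k x u)%E).

Definition Pq (k : E -> (E -> R) -> \bar R) : set (E * (E -> R)) :=
  [set p | is_dual p.2 /\ k p.1 p.2 = q p.1 p.2].

Definition pi1dom (F : E -> (E -> R) -> \bar R) : set E :=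
  [set x | exists u, is_dual u /\ F x u \is a fin_num].

Definition cone_diff (A B : set E) : set E :=
  [set z | exists l : R, 0 < l /\ exists a b, A a /\ B b /\ z = l *: (a - b)].

Definition closed_subspace (S : set E) : Prop :=
  closed S /\ S 0 /\ (forall (a : R) x y, S x -> S y -> S (a *: x + y)).

Definition infsum (f g : E -> (E -> R) -> \bar R) (x : E) (u : E -> R) : \bar R :=
  ereal_inf [set z | exists s t, is_dual s /\ is_dual t /\
      (forall w, s w + t w = u w) /\ z = (f x s + g x t)%E].

End BC.

(* Main.v *)
Require Import Defs.
From mathcomp Require Import all_boot all_order all_algebra.
From mathcomp Require Import all_classical all_reals all_analysis.
From mathcomp Require Import lra ring.
Import Order.TTheory GRing.Theory Num.Theory.
Import numFieldNormedType.Exports.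
Local Open Scope classical_set_scope.
Local Open Scope ring_scope.

(* Everything follows from exactness of the conjugate of the partial
   inf-convolution [h]: if [h^@(y, v) <= M] then [v = s + t] with
   [f^@(y, s) + g^@(y, t) <= M].  Indeed [h^@ >= h >= q] is then immediate,
   equality in [q <= f^@, g^@] is forced at every point of [Pq h^@], and
   [Pq k = Pq k^@] for every BC-function [k].

   Exactness is an Attouch-Brezis argument.  Put
   [P(z) = inf {f(a, s) - s(y) + g(b, t) - t(y) - v(b) + M : a - b = z}];
   then [P] is convex, [P(0) >= 0], and a subgradient [u] of [P] at [0] yields
   the decomposition [v = u + (v - u)].  The subgradient comes from Hahn-Banach
   once [P] is bounded above near [0] in the closed subspace [S] spanned by the
   differences of the domains.  For that, let [A_n] be the set of differences
   [a - b] with all data bounded by [n].  By Baire the closure of some [A_n]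
   contains a ball of [S], by convexity one centred at [0]; since sublevel sets
   of lsc convex functions are closed under the series [sum_k 2^-(k+1) c_k], a
   ball of half the radius lies in [A_n] itself. *)

(** * Hahn-Banach: a linear functional below a sublinear one *)

Section Sublinear.
Set Implicit Arguments. Unset Strict Implicit.
Variables (R : realType) (V : lmodType R).
Implicit Types p r : V -> R.

(** Positive homogeneity is required as an inequality only, which is what the infima below deliver;
    applying it to the inverse scalar gives equality. *)
Definition sublinear p :=
  (forall x y, p (x + y) <= p x + p y) /\
  (forall (a : R) x, 0 < a -> p (a *: x) <= a * p x).

Lemma sublinear_homo p (a : R) x : sublinear p -> 0 < a -> p (a *: x) = a * p x.
Proof.
move=> [_ ph] a0; apply/eqP; rewrite eq_le ph//=.
rewrite -ler_pdivlMl//; apply: le_trans (ph _ _ _); last by rewrite invr_gt0.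
by rewrite scalerA mulVf ?gt_eqF// scale1r.
Qed.

Lemma sublinear0 p : sublinear p -> p 0 = 0.
Proof. by move=> sp; have := sublinear_homo 0 sp (ltr0Sn R 1); rewrite scaler0; lra. Qed.

Lemma sublinear_ge p x : sublinear p -> - p (- x) <= p x.
Proof.
by move=> sp; have := sp.1 x (- x); rewrite subrr (sublinear0 sp); lra.
Qed.

(* The directional derivative [inf_(t >= 0) (p (x + t *: y) - t * p y)] is again
   sublinear and below [p]; minimality makes [p] superadditive. *)
Lemma minimal_sublinear_linear p : sublinear p ->
  (forall r, sublinear r -> (forall x, r x <= p x) -> forall x, p x <= r x) ->
  forall (a : R) x y, p (a *: x + y) = a * p x + p y.
Proof.
move=> sp pmin.
have pD x y : p (x + y) = p x + p y.
  apply/eqP; rewrite eq_le sp.1/=.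
  pose A z := [set c | exists2 t : R, 0 <= t & c = p (z + t *: y) - t * p y].
  have Alb z : lbound (A z) (- p (- z)).
    move=> _ [t t0 ->].
    have tp : p (t *: y) = t * p y.
      move: t0; rewrite le_eqVlt => /predU1P[<-|t0]; last exact: sublinear_homo.
      by rewrite scale0r mul0r sublinear0.
    have := sp.1 (- z) (z + t *: y).
    by rewrite addrA addNr add0r tp; lra.
  have Aub z : has_lbound (A z) by exists (- p (- z)).
  have An z : A z (p z) by exists 0 => //; rewrite scale0r addr0 mul0r subr0.
  have Ane z : nonempty (A z) by exists (p z).
  pose r z := inf (A z).
  have rle z c : A z c -> r z <= c by move=> ?; apply: ge_inf.
  have rsub : sublinear r.
    split=> [u v|a u a0].
      rewrite -lerBlDr; apply: lb_le_inf => // _ [s s0 ->].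
      rewrite lerBlDr -lerBlDl; apply: lb_le_inf => // _ [t t0 ->].
      rewrite lerBlDl.
      apply: le_trans (rle _ (p (u + v + (s + t) *: y) - (s + t) * p y) _) _.
        by exists (s + t) => //; exact: addr_ge0.
      have := sp.1 (u + s *: y) (v + t *: y).
      by rewrite scalerDl addrACA; lra.
    rewrite -ler_pdivrMl//; apply: lb_le_inf => // _ [t t0 ->].
    rewrite ler_pdivrMl//; apply: rle; exists (a * t); first by rewrite mulr_ge0// ltW.
    by rewrite -scalerA -scalerDr sublinear_homo// mulrBr mulrA.
  have := pmin _ rsub (fun z => rle _ _ (An z)) x.
  have : A x (p (x + y) - p y) by exists 1; rewrite ?scale1r ?mul1r.
  by move/rle; lra.
have pN x : p (- x) = - p x.
  by have := pD x (- x); rewrite subrr sublinear0//; lra.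
move=> a x y; rewrite pD; congr (_ + _).
have [a0|a0|<-] := ltrgtP 0 a; last by rewrite scale0r mul0r sublinear0.
  exact: sublinear_homo.
by rewrite -[a]opprK scaleNr pN sublinear_homo ?oppr_gt0// !mulNr.
Qed.

(** Zorn's lemma for the sublinear functionals below [p], under the reversed pointwise order: a
    chain is bounded by its pointwise infimum, finite because every member stays above [- p (- x)],
    and a minimal functional is linear. *)
Lemma sublinear_dominates_linear p : sublinear p ->
  exists u : V -> R, (forall (a : R) x y, u (a *: x + y) = a * u x + u y) /\
                     (forall x, u x <= p x).
Proof.
move=> sp.
pose T := {r : V -> R | sublinear r /\ forall x, r x <= p x}.
pose t0 : T := exist _ p (conj sp (fun x => lexx _)).
pose le_rev (r s : T) := `[< forall x, sval s x <= sval r x >].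
have [|r s t /asboolP rs /asboolP st|A Atot|[r [sr rp]] rmin] := @ZL_preorder T t0 le_rev.
- by move=> r; apply/asboolP.
- by apply/asboolP => x; exact: le_trans (st x) (rs x).
- have [->|/set0P[a0 Aa0]] := eqVneq A set0; first by exists t0 => s [].
  pose B x := [set sval r x | r in A].
  have Blb x : lbound (B x) (- p (- x)).
    move=> _ [[r [sr rp]] _ <-] /=.
    by apply: le_trans (sublinear_ge x sr); rewrite lerN2.
  have Bub x : has_lbound (B x) by exists (- p (- x)).
  have Bne x : nonempty (B x) by exists (sval a0 x), a0.
  pose m x := inf (B x).
  have mle x (r : T) : A r -> m x <= sval r x by move=> Ar; apply: ge_inf => //; exists r.
  have sm : sublinear m.
    split=> [x y|a x apos].
      rewrite -lerBlDr; apply: lb_le_inf => // _ [r Ar <-].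
      rewrite lerBlDr -lerBlDl; apply: lb_le_inf => // _ [s As <-].
      rewrite lerBlDl.
      have [/asboolP sr|/asboolP rs] := Atot _ _ Ar As.
        apply: le_trans (mle _ _ As) _; apply: le_trans ((svalP s).1.1 x y) _.
        by rewrite lerD2r.
      apply: le_trans (mle _ _ Ar) _; apply: le_trans ((svalP r).1.1 x y) _.
      by rewrite lerD2l.
    rewrite -ler_pdivrMl//; apply: lb_le_inf => // _ [r Ar <-].
    rewrite ler_pdivrMl//; apply: le_trans (mle _ _ Ar) _.
    exact: (svalP r).1.2.
  have mp x : m x <= p x by exact: le_trans (mle x a0 Aa0) ((svalP a0).2 x).
  by exists (exist _ m (conj sm mp)) => r Ar; apply/asboolP => x; exact: mle.
exists r; split=> //; apply: minimal_sublinear_linear => // s ss sler x.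
have sp' z : s z <= p z by exact: le_trans (sler z) (rp z).
by have /asboolP := rmin (exist _ s (conj ss sp')) (introT (asboolP _) sler); exact.
Qed.
End Sublinear.

(** * Geometric convergence and Baire's theorem *)

Section CompleteSpaces.
Set Implicit Arguments. Unset Strict Implicit.
Variables (R : realType) (V : completeNormedModType R).
Implicit Types (p : nat -> V).

Lemma cvg_dist_le p (l a : V) (c : R) k : p @ \oo --> l ->
  (forall j, `|p (k + j)%N - a| <= c) -> `|l - a| <= c.
Proof.
move=> /cvgrPdist_lt pl pa; apply/ler_addgt0Pr => e e0.
have [N _ HN] := pl e e0.
have := HN (k + N)%N (leq_addl _ _); have := pa N.
by have := ler_distD (p (k + N)%N) l a; lra.
Qed.

Lemma expr2V_lt (C e : R) : 0 < e -> exists k, C / 2 ^+ k < e.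
Proof.
move=> e0; have [C0|C0] := leP C 0.
  by exists 0%N; rewrite expr0 divr1; exact: le_lt_trans C0 e0.
exists (Num.truncn (C / e)); rewrite ltr_pdivrMr ?exprn_gt0// mulrC -ltr_pdivrMr//.
apply: lt_le_trans (truncnS_gt _) _.
by rewrite -natrX ler_nat ltn_expl.
Qed.

Lemma geometric_cvg p (C : R) :
  (forall k, `|p k.+1 - p k| <= C / 2 ^+ k) ->
  exists2 l : V, p @ \oo --> l & forall k, `|l - p k| <= 2 * C / 2 ^+ k.
Proof.
move=> pC.
have C0 : 0 <= C by have := pC 0%N; rewrite expr0 divr1; exact: le_trans.
have pk k j : `|p (k + j)%N - p k| <= 2 * C / 2 ^+ k - 2 * C / 2 ^+ (k + j).
  elim: j => [|j IHj]; first by rewrite addn0 !subrr normr0.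
  have := pC (k + j)%N; rewrite addnS exprS invfM.
  have := ler_distD (p (k + j)%N) (p (k + j).+1) (p k).
  by move: IHj; lra.
have pk' k j : `|p (k + j)%N - p k| <= 2 * C / 2 ^+ k.
  by apply: le_trans (pk k j) _; rewrite gerBl divr_ge0 ?mulr_ge0 ?exprn_ge0.
have : cvg (p @ \oo).
  apply: cauchy_cvg; apply: cauchy_exP => e e0; rewrite /fmapE -ball_normE /ball_.
  have [n ne] := expr2V_lt (2 * C) e0.
  exists (p n), n => // m /= nm; rewrite distrC -(subnKC nm).
  exact: le_lt_trans (pk' _ _) ne.
rewrite cvg_ex => -[l pl]; exists l => // k.
exact: cvg_dist_le pl (pk' k).
Qed.

(** Baire's theorem in [S], with density of [C n] in a ball of [S] in place of an interior point of
    its closure. If it fails for every [n], shrinking balls centred in [S] can be chosen so that the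
    one of index [n + 1] misses [C n]; their centres converge to a point of [S] outside all
    [C n]. *)
Lemma baire_closed (S : set V) (x0 : V) (C : nat -> set V) :
  closed S -> S x0 -> (forall x, S x -> exists n, C n x) ->
  exists (n : nat) (z : V) (r : R), [/\ 0 < r, S z & forall w, S w -> `|w - z| < r ->
    forall e : R, 0 < e -> exists2 c, C n c & `|w - c| < e].
Proof.
move=> clS Sx0 SC; apply: contrapT => noball.
have step (nzr : nat * {zr : V * R | S zr.1 /\ 0 < zr.2}) :
  exists zr : {zr : V * R | S zr.1 /\ 0 < zr.2},
    [/\ `|(sval zr).1 - (sval nzr.2).1| <= (sval nzr.2).2 / 2,
        (sval zr).2 <= (sval nzr.2).2 / 2 &
        forall c, C nzr.1 c -> (sval zr).2 < `|(sval zr).1 - c|].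
  move: nzr => [n [[z r] /= [Sz r0]]].
  have [w [Sw wz [e e0 eC]]] : exists w, [/\ S w, `|w - z| < r / 2 &
      exists2 e, 0 < e & forall c, C n c -> e <= `|w - c|].
    apply: contrapT => nw; apply: noball; exists n, z, (r / 2); split=> //.
      by rewrite divr_gt0.
    move=> w Sw wz e e0; apply: contrapT => nc; apply: nw; exists w; split=> //.
    by exists e => // c Cc; rewrite leNgt; apply/negP => ?; apply: nc; exists c.
  have m0 : 0 < Num.min (r / 2) (e / 2) by rewrite lt_min !divr_gt0.
  (* Points of [C n] are at distance at least [e] from [w], so a radius of at most [e / 2] makes the
     new closed ball miss [C n]. *)
  exists (exist _ (w, Num.min (r / 2) (e / 2)) (conj Sw m0)) => /=; split.
  - exact: ltW.
  - by rewrite ge_min lexx.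
  - move=> c /eC; apply: lt_le_trans.
    by rewrite gt_min; apply/orP; right; lra.
have [f Pf] := choice step.
pose fix s n := if n is m.+1 then f (m, s m) else exist _ (x0, 1 : R) (conj Sx0 ltr01).
pose z n := (sval (s n)).1; pose r n := (sval (s n)).2.
have zS n : `|z n.+1 - z n| <= r n / 2 by have [] := Pf (n, s n).
have rS n : r n.+1 <= r n / 2 by have [] := Pf (n, s n).
have rj k j : r (k + j)%N <= r k / 2 ^+ j.
  elim: j => [|j IHj]; first by rewrite addn0 expr0 divr1.
  by rewrite addnS exprS invfM mulrCA; have := rS (k + j)%N; lra.
have [k|l zl _] := @geometric_cvg z (1 / 2).
  by apply: le_trans (zS k) _; have := rj 0%N k; rewrite add0n /r/=; lra.
(* The sequence shifted by [k] has increments at most [r k / 2 / 2 ^+ j], so its limit stays in the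
   [k]-th closed ball. *)
have lz k : `|l - z k| <= r k.
  have [j|l' zl' /(_ 0%N)] := @geometric_cvg (fun j => z (j + k)%N) (r k / 2).
    apply: le_trans (zS (j + k)%N) _; rewrite [(j + k)%N]addnC.
    by have := rj k j; lra.
  suff -> : l' = l by rewrite /= add0n expr0; lra.
  by apply: cvg_unique zl' _; move: zl; rewrite -(@cvg_shiftn k _ z (nbhs l)).
have Sl : S l.
  apply: (@closed_cvg _ _ \oo eventually_filter z) zl => //.
  by apply: nearW => n; exact: (svalP (s n)).1.
have [n Cnl] := SC l Sl.
have [_ _ /(_ l Cnl)] := Pf (n, s n).
by rewrite -/(z n.+1) -/(r n.+1) distrC ltNge lz.
Qed.

End CompleteSpaces.

(** * Convex combinations with dyadic weights *)

Section DyadicAverages.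
Set Implicit Arguments. Unset Strict Implicit.
Variables (R : realType) (V : normedModType R).
Implicit Types (c : nat -> V) (C : R).

(** This is the sum of [2^-(k+1) c_k] for [k < n] plus [2^-n c_n]: the last term takes the remaining
    weight, so that it is a true convex combination. *)
Fixpoint dyadic_avg c n : V :=
  if n is m.+1 then 2^-1 *: c 0%N + 2^-1 *: dyadic_avg (fun k => c k.+1) m
  else c 0%N.

(** The step only replaces [2^-n c_n] by [2^-(n+1) (c_n + c_(n+1))]. *)
Lemma dyadic_avg_step c C n : (forall k, `|c k| <= C) ->
  `|dyadic_avg c n.+1 - dyadic_avg c n| <= C / 2 ^+ n.
Proof.
elim: n c => [|n IHn] c cC.
  have -> : dyadic_avg c 1 - dyadic_avg c 0 = 2^-1 *: (c 1%N - c 0%N).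
    have -> : dyadic_avg c 0 = 2^-1 *: c 0%N + 2^-1 *: c 0%N.
      rewrite -scalerDl; have -> : 2^-1 + 2^-1 = 1 :> R by lra.
      by rewrite scale1r.
    by rewrite /= scalerBr opprD addrACA subrr add0r.
  rewrite normrZ ger0_norm// expr0 divr1.
  by have := ler_normB (c 1%N) (c 0%N); have := cC 1%N; have := cC 0%N; lra.
have -> : dyadic_avg c n.+2 - dyadic_avg c n.+1 =
    2^-1 *: (dyadic_avg (fun k => c k.+1) n.+1 - dyadic_avg (fun k => c k.+1) n).
  by rewrite scalerBr /= opprD addrACA subrr add0r.
rewrite normrZ ger0_norm// exprS invfM mulrCA ler_pM2l//.
exact: IHn.
Qed.

(** The recursion says that [w_k / 2 = c_k / 2 + (w_(k+1) / 2) / 2]; unfolded [n] times, it leaves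
    the error [2^-n (w_n / 2 - c_n)]. *)
Lemma dyadic_avg_approx (w c : nat -> V) C n :
  (forall k, w k.+1 = 2 *: (w k - c k)) ->
  (forall k, `|2^-1 *: w k - c k| <= C) ->
  `|2^-1 *: w 0%N - dyadic_avg c n| <= C / 2 ^+ n.
Proof.
elim: n w c => [|n IHn] w c wS wC; first by rewrite expr0 divr1.
have -> : 2^-1 *: w 0%N - dyadic_avg c n.+1 =
    2^-1 *: (2^-1 *: w 1%N - dyadic_avg (fun k => c k.+1) n).
  rewrite wS [2^-1 *: (2 *: _)]scalerA mulVf// scale1r /=.
  by rewrite !scalerBr opprD addrA.
rewrite normrZ ger0_norm// exprS invfM mulrCA ler_pM2l//.
exact: (IHn (fun k => w k.+1)).
Qed.

End DyadicAverages.

(** * Continuous linear functionals *)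

Section Duals.
Set Implicit Arguments. Unset Strict Implicit.
Variables (R : realType) (E : completeNormedModType R).
Implicit Types (u v : E -> R).

Lemma dualD u x y : is_dual u -> u (x + y) = u x + u y.
Proof. by move=> [/(_ 1 x y)]; rewrite scale1r mul1r. Qed.

Lemma dual0 u : is_dual u -> u 0 = 0.
Proof. by move=> /(dualD 0 0); rewrite addr0; lra. Qed.

Lemma dualZ u (a : R) x : is_dual u -> u (a *: x) = a * u x.
Proof. by move=> du; have [/(_ a x 0)] := du; rewrite dual0// !addr0. Qed.

Lemma dualN u x : is_dual u -> u (- x) = - u x.
Proof. by move=> du; rewrite -scaleN1r dualZ// mulN1r. Qed.

Lemma dualB u x y : is_dual u -> u (x - y) = u x - u y.
Proof. by move=> du; rewrite dualD// dualN. Qed.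

Lemma bounded_is_dual u (C : R) :
  (forall (a : R) x y, u (a *: x + y) = a * u x + u y) ->
  (forall x, `|u x| <= C * `|x|) -> is_dual u.
Proof.
move=> ul uC; split=> // x; apply/cvgrPdist_lt => e e0.
have C1 : 0 < `|C| + 1 by rewrite ltr_wpDl.
near=> y.
have -> : u x - u y = u (x - y).
  by have := ul (-1) y x; rewrite scaleN1r mulN1r addrC => ->; rewrite addrC.
apply: le_lt_trans (uC _) _.
apply: le_lt_trans (_ : (`|C| + 1) * `|x - y| < _).
  by rewrite ler_wpM2r// ler_wpDr// ler_norm.
rewrite -ltr_pdivlMl//; near: y.
by apply: cvgr_dist_lt => //; rewrite mulr_gt0// invr_gt0.
Unshelve. all: by end_near. Qed.

Lemma dual_bounded u : is_dual u ->
  exists2 C : R, 0 <= C & forall x, `|u x| <= C * `|x|.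
Proof.
move=> du; have [_ /(_ 0)/cvgrPdist_lt/(_ 1 ltr01)] := du.
rewrite -nbhs_nearE => /nbhs_ballP[d /= d0 ud].
exists (2 / d) => [|x]; first by rewrite divr_ge0// ltW.
have [->|x0] := eqVneq x 0; first by rewrite dual0// !normr0 mulr0.
have nx0 : 0 < `|x| by rewrite normr_gt0.
have y0 : 0 < d / 2 / `|x| by rewrite !divr_gt0.
have := ud ((d / 2 / `|x|) *: x); rewrite -ball_normE /= sub0r normrN normrZ.
rewrite (gtr0_norm y0) divfK ?gt_eqF// ltr_pdivrMr// => /(_ _)/wrap[].
  by rewrite mulrDr mulr1 ltrDl.
rewrite dual0// sub0r normrN dualZ// normrM gtr0_norm// => /ltW.
rewrite -ler_pdivlMl// => /le_trans; apply; rewrite mulr1.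
lra.
Qed.

Lemma dual_comb u v (a b : R) : is_dual u -> is_dual v ->
  is_dual (fun z => a * u z + b * v z).
Proof.
move=> du dv; have [C C0 uC] := dual_bounded du; have [D D0 vD] := dual_bounded dv.
apply: (@bounded_is_dual _ (`|a| * C + `|b| * D)) => [c x y|x].
  by rewrite du.1 dv.1; ring.
rewrite mulrDl; apply: le_trans (ler_normD _ _) _.
by rewrite !normrM -!mulrA lerD// ler_wpM2l.
Qed.

Lemma dual_add u v : is_dual u -> is_dual v -> is_dual (fun z => u z + v z).
Proof.
move=> du dv; have := dual_comb 1 1 du dv.
by under eq_fun do rewrite !mul1r.
Qed.

Lemma dual_sub u v : is_dual u -> is_dual v -> is_dual (fun z => u z - v z).
Proof.
move=> du dv; have := dual_comb 1 (-1) du dv.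
by under eq_fun do rewrite mul1r mulN1r.
Qed.

Lemma opnorm_le u (C : R) : 0 <= C -> (forall x, `|u x| <= C * `|x|) ->
  (opnorm u <= C%:E)%E.
Proof.
move=> C0 uC; apply: ge_ereal_sup => _ [x x1 <-]; rewrite lee_fin.
by apply: le_trans (uC x) _; rewrite ler_piMr.
Qed.

End Duals.

(** * Sublevel sets with bounded data and their convex series *)

Section Sublevels.
Set Implicit Arguments. Unset Strict Implicit.
Variables (R : realType) (E : completeNormedModType R).
Implicit Types (F : E -> (E -> R) -> \bar R) (s t : E -> R) (n : R).

(** The functional is bounded pointwise rather than through [opnorm], a form that passes directly to
    convex combinations and pointwise limits. *)
Definition sublevel F n (a : E) s : Prop :=
  [/\ `|a| <= n, is_dual s, forall z, `|s z| <= n * `|z| & (F a s <= n%:E)%E].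

Lemma sublevel_mono F m n a s : m <= n -> sublevel F m a s -> sublevel F n a s.
Proof.
move=> mn [am ds sm Fm]; split=> //; first exact: le_trans am mn.
- by move=> z; apply: le_trans (sm z) _; rewrite ler_wpM2r.
- by apply: le_trans Fm _; rewrite lee_fin.
Qed.

Lemma sublevel_exists F a s (c : R) : is_dual s -> (F a s <= c%:E)%E ->
  exists n, sublevel F n a s.
Proof.
move=> ds Fc; have [C C0 sC] := dual_bounded ds.
exists (`|a| + C + `|c|); split=> //.
- by rewrite -addrA lerDl addr_ge0.
- by move=> z; apply: le_trans (sC z) _; rewrite ler_wpM2r// addrAC lerDr addr_ge0.
- apply: le_trans Fc _; rewrite lee_fin; apply: le_trans (ler_norm c) _.
  by rewrite lerDr addr_ge0.
Qed.

Lemma convex_fun_le F a s b t (l x y : R) : convex_fun F ->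
  is_dual s -> is_dual t -> 0 < l < 1 -> (F a s <= x%:E)%E -> (F b t <= y%:E)%E ->
  (F (l *: a + (1 - l) *: b)%R (fun z => l * s z + (1 - l) * t z)%R
    <= (l * x + (1 - l) * y)%R%:E)%E.
Proof.
move=> cF ds dt l01 Fx Fy; apply: le_trans (cF _ _ _ _ _ ds dt l01) _.
have /andP[l0 l1] := l01.
by rewrite (EFinD (l * x)) !EFinM leeD// lee_pmul2l// lte_fin subr_gt0.
Qed.

Lemma sublevel_convex F n a s b t (l : R) : convex_fun F -> 0 < l < 1 ->
  sublevel F n a s -> sublevel F n b t ->
  sublevel F n (l *: a + (1 - l) *: b) (fun z => l * s z + (1 - l) * t z).
Proof.
move=> cF l01 [an ds sn Fa] [bn dt tn Fb].
have /andP[l0 l1] := l01; have l1' : 0 < 1 - l by rewrite subr_gt0.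
split.
- apply: le_trans (ler_normD _ _) _; rewrite !normrZ !gtr0_norm//.
  have -> : n = l * n + (1 - l) * n by ring.
  by apply: lerD; rewrite ler_wpM2l// ltW.
- exact: dual_comb.
- move=> z; apply: le_trans (ler_normD _ _) _.
  rewrite !normrM (gtr0_norm l0) (gtr0_norm l1')//.
  have -> : n * `|z| = l * (n * `|z|) + (1 - l) * (n * `|z|) by ring.
  by apply: lerD; rewrite ler_wpM2l// ltW.
- have := convex_fun_le cF ds dt l01 Fa Fb.
  by have -> : l * n + (1 - l) * n = n by ring.
Qed.

Lemma sublevel_dyadic_avg F n (a : nat -> E) (s : nat -> E -> R) K :
  convex_fun F -> (forall k, sublevel F n (a k) (s k)) ->
  sublevel F n (dyadic_avg a K) (fun z => dyadic_avg (fun k => s k z) K).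
Proof.
move=> cF; elim: K a s => [|K IHK] a s asn; first exact: asn.
have l01 : 0 < (2^-1 : R) < 1.
  by rewrite invr_gt0 invf_lt1 ?ltr0n ?ltr1n.
have := sublevel_convex cF l01 (asn 0%N)
  (IHK (fun k => a k.+1) (fun k => s k.+1) (fun k => asn k.+1)).
by have -> : 1 - 2^-1 = 2^-1 :> R by lra.
Qed.

(** [lsc] refers to the operator norm on functionals; the rate, uniform for bounded [z], turns
    pointwise convergence of [s] into convergence in that norm. *)
Lemma sublevel_limit F n (C : R) (a : nat -> E) (s : nat -> E -> R) a' s' :
  lsc F -> (forall k, sublevel F n (a k) (s k)) ->
  a @ \oo --> a' -> (forall z, (fun k => s k z) @ \oo --> s' z) ->
  (forall k z, `|s' z - s k z| <= C * `|z| / 2 ^+ k) ->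
  sublevel F n a' s'.
Proof.
move=> lF asn aa' ss' sC.
have an k : `|a k| <= n by have [] := asn k.
have ds k : is_dual (s k) by have [] := asn k.
have sn k z : `|s k z| <= n * `|z| by have [] := asn k.
have Fn k : (F (a k) (s k) <= n%:E)%E by have [] := asn k.
have sn' z : `|s' z| <= n * `|z|.
  have := @cvg_dist_le R _ _ _ 0 (n * `|z|) 0%N (ss' z).
  by rewrite subr0; apply=> j; rewrite subr0.
have ds' : is_dual s'.
  apply: bounded_is_dual sn' => c x y.
  have sxy := ss' (c *: x + y).
  have e : (fun k => s k (c *: x + y)) = (fun k => c * s k x + s k y).
    by apply/funext => k; rewrite (ds k).1.
  rewrite e in sxy.
  apply: norm_cvg_unique sxy _; apply: cvgD (ss' y); apply: cvgMl_tmp (ss' x).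
split=> //.
  have := @cvg_dist_le R _ _ _ 0 n 0%N aa'.
  by rewrite subr0; apply=> j; rewrite subr0.
rewrite leNgt; apply/negP => /(lF _ _ ds')[d d0 Fd].
have /cvgrPdist_lt/(_ d d0)[N _ HN] := aa'.
have [M CM] := expr2V_lt `|C| d0.
suff : (n%:E < F (a (N + M)%N) (s (N + M)%N))%E by rewrite ltNge Fn.
apply: Fd => //.
  by rewrite distrC; apply: HN; rewrite /= leq_addr.
have CNM : `|C| / 2 ^+ (N + M) < d.
  apply: le_lt_trans CM; rewrite ler_wpM2l// lef_pV2 ?posrE ?exprn_gt0//.
  by rewrite ler_weXn2l// ?leq_addl//; lra.
apply: le_lt_trans (@opnorm_le _ _ _ (`|C| / 2 ^+ (N + M)) _ _) _ => //.
move=> z; rewrite distrC; apply: le_trans (sC _ _) _.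
by rewrite mulrAC ler_wpM2r// ler_wpM2r ?invr_ge0// ler_norm.
Qed.

(** Dyadic averages of a bounded sequence are Cauchy and by convexity remain in the sublevel set.
    The limit functional is built point by point; the bound [n * |z|] on each [s k z] gives the
    uniform rate. *)
Lemma sublevel_cs_closed F n (a : nat -> E) (s : nat -> E -> R) :
  convex_fun F -> lsc F -> (forall k, sublevel F n (a k) (s k)) ->
  exists a' s', sublevel F n a' s' /\ dyadic_avg a @ \oo --> a'.
Proof.
move=> cF lF asn.
have [k|a' aa' _] := @geometric_cvg _ E (dyadic_avg a) n.
  by apply: dyadic_avg_step => j; have [] := asn j.
have /choice[s' ss'] z : exists l : R,
    (fun k => dyadic_avg (fun k => s k z) k) @ \oo --> l /\
    forall k, `|l - dyadic_avg (fun k => s k z) k| <= 2 * (n * `|z|) / 2 ^+ k.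
  have [k|l sl lC] := @geometric_cvg _ R (dyadic_avg (fun k => s k z)) (n * `|z|).
    by apply: dyadic_avg_step => j; have [_ _] := asn j.
  by exists l.
exists a', s'; split=> //.
apply: (@sublevel_limit F n (2 * n) _ (fun k z => dyadic_avg (fun k => s k z) k)).
- by [].
- by move=> k; exact: sublevel_dyadic_avg.
- by [].
- by move=> z; have [] := ss' z.
- by move=> k z; have [_ /(_ k)] := ss' z; rewrite mulrA.
Qed.

End Sublevels.

(** * An open mapping argument for differences of the domains *)

Section OpenMapping.
Set Implicit Arguments. Unset Strict Implicit.
Variables (R : realType) (E : completeNormedModType R).
Variables (f g : E -> (E -> R) -> \bar R).
Hypotheses (pf : proper_fun f) (cf : convex_fun f) (lf : lsc f).
Hypotheses (pg : proper_fun g) (cg : convex_fun g) (lg : lsc g).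
Implicit Types (n : R) (F : E -> (E -> R) -> \bar R).

(** The set [A_n] of the opening comment, with a real bound [n]. *)
Definition sublevel_diff n (z : E) : Prop :=
  exists a s b t, [/\ sublevel f n a s, sublevel g n b t & z = a - b].

Lemma sublevel_diff_mono m n z : m <= n -> sublevel_diff m z -> sublevel_diff n z.
Proof.
move=> mn [a [s [b [t [fa gb ->]]]]]; exists a, s, b, t.
by split=> //; exact: sublevel_mono mn _.
Qed.

Lemma sublevel_diff_convex n z w (l : R) : 0 < l < 1 ->
  sublevel_diff n z -> sublevel_diff n w ->
  sublevel_diff n (l *: z + (1 - l) *: w).
Proof.
move=> l01 [a [s [b [t [fa gb ->]]]]] [a' [s' [b' [t' [fa' gb' ->]]]]].
exists (l *: a + (1 - l) *: a'), (fun z => l * s z + (1 - l) * s' z).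
exists (l *: b + (1 - l) *: b'), (fun z => l * t z + (1 - l) * t' z).
split; [exact: sublevel_convex|exact: sublevel_convex|].
by rewrite !scalerBr opprD addrACA.
Qed.

Lemma sublevel_fin_num F n a s : proper_fun F -> sublevel F n a s -> pi1dom F a.
Proof.
move=> [_ Fy] [_ ds _ Fn]; exists s; split=> //.
rewrite fin_numE; apply/andP; split; first by apply/eqP; exact: Fy.
by apply/eqP => FE; move: Fn; rewrite FE leye_eq.
Qed.

Lemma sublevel_diff_cone n z : sublevel_diff n z -> cone_diff (pi1dom f) (pi1dom g) z.
Proof.
move=> [a [s [b [t [fa gb ->]]]]]; exists 1; split=> //; exists a, b.
by rewrite scale1r; split; [|split] => //; apply: sublevel_fin_num; eauto.
Qed.

Lemma pi1dom_sublevel F a : pi1dom F a -> exists s n, sublevel F n a s.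
Proof.
move=> [s [ds /fineK Ffin]]; exists s; apply: sublevel_exists (fine (F a s)) ds _.
by rewrite Ffin.
Qed.

(** Countable cover of the cone for Baire's theorem, one index being both bound and multiple. As 0
    lies in the cone, the domains share a point, [a0 - b0 = 0]; this null difference takes up the
    weight left by [l / k.+1%:R]. *)
Lemma cone_sublevel_diff z : cone_diff (pi1dom f) (pi1dom g) 0 ->
  cone_diff (pi1dom f) (pi1dom g) z ->
  exists k w, sublevel_diff k.+1%:R w /\ z = k.+1%:R *: w.
Proof.
move=> [l0 [l00 [a0 [b0 [fa0 [gb0 ab0]]]]]] [l [lpos [a [b [fa [gb ->]]]]]].
have {}ab0 : a0 - b0 = 0.
  by move/esym/eqP: ab0; rewrite scaler_eq0 (gt_eqF l00) /= => /eqP.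
have [s [n1 fas]] := pi1dom_sublevel fa; have [t [n2 gbt]] := pi1dom_sublevel gb.
have [s0 [n3 fas0]] := pi1dom_sublevel fa0; have [t0 [n4 gbt0]] := pi1dom_sublevel gb0.
pose k := Num.bound (`|l| + `|n1| + `|n2| + `|n3| + `|n4|).
have lek x : x <= `|l| + `|n1| + `|n2| + `|n3| + `|n4| -> x < k.+1%:R.
  move=> xle; apply: lt_trans (_ : k%:R < _); last by rewrite ltr_nat.
  by apply: le_lt_trans xle _; apply: archi_boundP; rewrite !addr_ge0.
have n_le (x : R) : x <= `|x| by exact: ler_norm.
have ge0 (x : R) : 0 <= `|x| by exact: normr_ge0.
have [nl nn1 nn2 nn3 nn4] : [/\ l < k.+1%:R, n1 < k.+1%:R, n2 < k.+1%:R,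
    n3 < k.+1%:R & n4 < k.+1%:R].
  by split; apply: lek; move: (n_le l) (n_le n1) (n_le n2) (n_le n3) (n_le n4)
    (ge0 l) (ge0 n1) (ge0 n2) (ge0 n3) (ge0 n4); lra.
have k0 : 0 < k.+1%:R :> R by rewrite ltr0n.
exists k, ((l / k.+1%:R) *: (a - b) + (1 - l / k.+1%:R) *: (a0 - b0)); split.
  apply: sublevel_diff_convex.
  - by rewrite divr_gt0//= ltr_pdivrMr// mul1r.
  - by exists a, s, b, t; split=> //;
      [exact: sublevel_mono (ltW nn1) fas|exact: sublevel_mono (ltW nn2) gbt].
  - by exists a0, s0, b0, t0; split=> //;
      [exact: sublevel_mono (ltW nn3) fas0|exact: sublevel_mono (ltW nn4) gbt0].
by rewrite ab0 scaler0 addr0 scalerA mulrCA mulfV ?mulr1// gt_eqF.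
Qed.

(* The defect [w - c] of an approximation is doubled and approximated again, so
   that [w / 2] is the sum of the [2^-(k+1)] multiples of the approximants. *)
Lemma sublevel_diff_dense (S : set E) n (r : R) :
  S 0 -> (forall (a : R) x y, S x -> S y -> S (a *: x + y)) ->
  (forall z, sublevel_diff n z -> S z) ->
  (forall w, S w -> `|w| < r -> forall e, 0 < e ->
     exists2 c, sublevel_diff n c & `|w - c| < e) ->
  forall w, S w -> `|w| < r -> sublevel_diff n (2^-1 *: w).
Proof.
move=> S0 Slin AS dense w0 Sw0 w0r.
have r0 : 0 < r by exact: le_lt_trans w0r.
(* Accuracy [r / 2] keeps the doubled defect in the ball of radius [r], so the approximation can be
   iterated. *)
have /choice[h Ph] (w : {w | S w /\ `|w| < r}) : exists c : E,
    sublevel_diff n c /\ `|sval w - c| < r / 2.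
  have [c Ac wc] :=
    dense _ (svalP w).1 (svalP w).2 (r / 2) (divr_gt0 r0 (ltr0Sn R 1)).
  by exists c.
have next (w : {w | S w /\ `|w| < r}) :
    S (2 *: (sval w - h w)) /\ `|2 *: (sval w - h w)| < r.
  have [Ac wc] := Ph w; split; last by rewrite normrZ ger0_norm//; lra.
  rewrite -[X in S X]addr0; apply: (Slin) S0.
  by rewrite addrC -scaleN1r; apply: Slin; [exact: AS|exact: (svalP w).1].
pose fix ww k := if k is j.+1 then exist _ _ (next (ww j))
                 else exist (fun w => S w /\ `|w| < r) w0 (conj Sw0 w0r).
pose w k := sval (ww k); pose c k := h (ww k).
have wr k : `|w k| < r by exact: (svalP (ww k)).2.
have wck k : `|w k - c k| < r / 2 by have [] := Ph (ww k).
have bnd k : `|2^-1 *: w k - c k| <= r.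
  have -> : 2^-1 *: w k - c k = (w k - c k) - 2^-1 *: w k.
    rewrite addrAC; congr (_ - _).
    by rewrite -{2}[w k]scale1r -scalerBl; congr (_ *: _); lra.
  apply: le_trans (ler_normB _ _) _; rewrite normrZ ger0_norm//.
  by have := wr k; have := wck k; lra.
have wc K := @dyadic_avg_approx _ _ w c r K (fun k => erefl) bnd.
have Ac k : sublevel_diff n (c k) by have [] := Ph (ww k).
have /choice[abst Pab] k : exists q : (E * (E -> R)) * (E * (E -> R)),
    [/\ sublevel f n q.1.1 q.1.2, sublevel g n q.2.1 q.2.2 & c k = q.1.1 - q.2.1].
  by have [a [s [b [t]]]] := Ac k; exists ((a, s), (b, t)).
pose a k := (abst k).1.1; pose b k := (abst k).2.1.
(* The two components are averaged separately; the limits lie in the sublevel sets of [f] and [g],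
   and their difference is the limit [w0 / 2] of the averages of [c]. *)
have [|a' [s' [fa' aa']]] := @sublevel_cs_closed _ _ f n a (fun k => (abst k).1.2) cf lf.
  by move=> k; have [] := Pab k.
have [|b' [t' [gb' bb']]] := @sublevel_cs_closed _ _ g n b (fun k => (abst k).2.2) cg lg.
  by move=> k; have [] := Pab k.
exists a', s', b', t'; split=> //.
have avgB K : dyadic_avg c K = dyadic_avg a K - dyadic_avg b K.
  have : forall k, c k = a k - b k by move=> k; have [] := Pab k.
  move: c a b {wck bnd wc Ac Pab aa' bb'}.
  elim: K => [|K IHK] c a b cab /=; first exact: cab.
  by rewrite cab (IHK _ _ _ (fun k => cab k.+1)) !scalerBr opprD addrACA.
have cw : dyadic_avg c @ \oo --> 2^-1 *: w0.
  apply/cvgrPdist_lt => e e0; have [N Ne] := expr2V_lt r e0.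
  exists N => // K /= NK; apply: le_lt_trans (wc K) _; apply: le_lt_trans Ne.
  rewrite ler_wpM2l ?(ltW r0)// lef_pV2 ?posrE ?exprn_gt0//.
  by rewrite ler_weXn2l//; lra.
apply: norm_cvg_unique cw _.
rewrite (_ : dyadic_avg c = fun K => dyadic_avg a K - dyadic_avg b K).
  exact: cvgB.
exact/funext.
Qed.

Lemma sublevel_diff_ball : closed_subspace (cone_diff (pi1dom f) (pi1dom g)) ->
  exists n r, 0 < r /\ forall w, cone_diff (pi1dom f) (pi1dom g) w ->
    `|w| <= r -> sublevel_diff n w.
Proof.
set S := cone_diff _ _ => -[clS [S0 Slin]].
have SZ (a : R) x : S x -> S (a *: x).
  by move=> Sx; rewrite -[_ *: _]addr0; apply: Slin.
have [z /(cone_sublevel_diff S0)[k [w [Aw ->]]]|k [z0 [r [r0 Sz0 dense]]]] :=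
  @baire_closed _ E S 0
    (fun k => [set z | exists2 w, sublevel_diff k.+1%:R w & z = k.+1%:R *: w])
    clS S0.
  by exists k, w.
(* Recentring at 0: [- z0 = q c] with [c] in [A_q]. If [m d] approximates [n w + z0], where
   [n = m + q], then [(m / n) d + (q / n) c] approximates [w]. *)
have [p [c [Ac z0c]]] := cone_sublevel_diff S0 (SZ (-1) _ Sz0).
pose m : R := k.+1%:R; pose q : R := p.+1%:R; pose n := m + q.
have m0 : 0 < m by rewrite ltr0n.
have q0 : 0 < q by rewrite ltr0n.
have n0 : 0 < n by exact: addr_gt0.
have {}dense : forall w, S w -> `|w| < r / n -> forall e, 0 < e ->
     exists2 d, sublevel_diff n d & `|w - d| < e.
  move=> w Sw wr e e0.
  have [||_ [d Ad ->] wd] := dense (n *: w + z0) _ _ (n * e) (mulr_gt0 n0 e0).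
  - exact: Slin.
  - by rewrite addrK normrZ gtr0_norm// mulrC -ltr_pdivlMr.
  exists ((m / n) *: d + (1 - m / n) *: c).
    apply: sublevel_diff_convex.
    - by rewrite divr_gt0//= ltr_pdivrMr// mul1r /n ltrDl.
    - by apply: sublevel_diff_mono Ad; rewrite lerDl ltW.
    - by apply: sublevel_diff_mono Ac; rewrite lerDr ltW.
  have -> : w - ((m / n) *: d + (1 - m / n) *: c) = n^-1 *: (n *: w + z0 - m *: d).
    have -> : z0 = - q *: c.
      by rewrite scaleNr -[q *: c]z0c scaleN1r opprK.
    have -> : 1 - m / n = q / n by rewrite /n; field; rewrite gt_eqF.
    rewrite !scalerDr !scalerN !scalerA mulVf ?gt_eqF// scale1r mulrN scaleNr.
    by rewrite opprD -!addrA; congr (_ + _); rewrite addrC ![_^-1 * _]mulrC.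
  by rewrite normrZ gtr0_norm ?invr_gt0// mulrC ltr_pdivrMr// mulrC.
(* Of the factor 4, one 2 pays for the halving in [sublevel_diff_dense], the other makes the bound
   on [2 *: w] strict. *)
exists n, (r / n / 4); split; first by rewrite !divr_gt0.
move=> w Sw wr; have -> : w = 2^-1 *: (2 *: w).
  by rewrite scalerA mulVf// scale1r.
have rn : 0 < r / n by rewrite divr_gt0.
apply: (sublevel_diff_dense S0 Slin _ dense) (SZ _ _ Sw) _.
  by move=> z; exact: sublevel_diff_cone.
by rewrite normrZ ger0_norm//; lra.
Qed.

End OpenMapping.

(** * Subgradients from Hahn-Banach *)

Section Subgradient.
Set Implicit Arguments. Unset Strict Implicit.
Variables (R : realType) (E : completeNormedModType R).

(* [T] plays the epigraph of a convex function that is nonnegative at 0.  The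
   sublinear functional fed to Hahn-Banach is its positively homogeneous hull
   inf-convolved with [K * `|.|], which makes it finite on all of [E]. *)
Lemma subgradient_at_zero (S : set E) (T : E -> R -> Prop) (r K0 : R) :
  S 0 -> (forall (a : R) x, S x -> S (a *: x)) -> 0 < r ->
  (forall d d' c c' (l : R), 0 < l < 1 -> T d c -> T d' c' ->
     T (l *: d + (1 - l) *: d') (l * c + (1 - l) * c')) ->
  (forall c, T 0 c -> 0 <= c) -> (forall d c, T d c -> S d) ->
  (forall w, S w -> `|w| <= r -> exists2 c, c <= K0 & T w c) ->
  exists u, is_dual u /\ forall d c, T d c -> u d <= c.
Proof.
move=> S0 SZ r0 Tconv T0 TS Tball.
have [c0 c0K Tc0] : exists2 c, c <= K0 & T 0 c by apply: Tball => //; rewrite normr0 ltW.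
have K00 : 0 <= K0 := le_trans (T0 _ Tc0) c0K.
pose K := K0 / r; have Kge0 : 0 <= K by rewrite divr_ge0 // ltW.
(* Combine [(d, c)] with a point of [T] over the opposite vector of norm [r], the weights making the
   first component vanish; nonnegativity at 0 then bounds [c] from below. *)
have Tlow d c : T d c -> - K * `|d| <= c.
  move=> Tdc; have [d0|d0] := eqVneq d 0.
    by move: Tdc; rewrite d0 normr0 mulr0; exact: T0.
  have nd0 : 0 < `|d| by rewrite normr_gt0.
  have [|c' c'K Tc'] := Tball (- (r / `|d|) *: d) (SZ _ _ (TS _ _ Tdc)).
    by rewrite normrZ normrN gtr0_norm ?divr_gt0// divfK// gt_eqF.
  pose m := `|d| / r; have m0 : 0 < m by rewrite divr_gt0.
  have m1 : 0 < 1 + m by rewrite addr_gt0.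
  have := Tconv _ _ _ _ (1 + m)^-1 _ Tdc Tc'.
  have -> : 1 - (1 + m)^-1 = m / (1 + m) by field; rewrite gt_eqF.
  have -> : (1 + m)^-1 *: d + (m / (1 + m)) *: (- (r / `|d|) *: d) = 0.
    rewrite scalerA -scalerDl (_ : _ + _ = 0) ?scale0r// /m.
    by field; rewrite !gt_eqF// -/m; nra.
  rewrite invr_gt0 invf_lt1// m1 ltrDl m0 => /(_ isT)/T0.
  rewrite (_ : _ * c + _ = (1 + m)^-1 * (c + m * c')); last by ring.
  rewrite pmulr_rge0 ?invr_gt0// => cm.
  have -> : - K * `|d| = - (m * K0) by rewrite /K /m; ring.
  by have := ler_wpM2l (ltW m0) c'K; lra.
pose A z := [set e | exists l d c, [/\ 0 < l, T d c & e = l * c + K * `|z - l *: d|]].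
have Alb z : lbound (A z) (- (K * `|z|)).
  move=> _ [l [d [c [l0 Tdc ->]]]].
  have := ler_wpM2l (ltW l0) (Tlow _ _ Tdc).
  have : K * (l * `|d|) <= K * `|z| + K * `|z - l *: d|.
    rewrite -mulrDr ler_wpM2l// -[l in l * _]gtr0_norm// -normrZ.
    by rewrite -[X in `|X| <= _](subKr z); exact: ler_normB.
  by lra.
have Aub z : has_lbound (A z) by exists (- (K * `|z|)).
have Ane z : nonempty (A z).
  by exists (1 * c0 + K * `|z - 1 *: 0|), 1, 0, c0.
pose p z := inf (A z).
have ple z e : A z e -> p z <= e by move=> ?; exact: ge_inf.
have sp : sublinear p.
  split=> [x y|a x a0].
    rewrite -lerBlDr; apply: lb_le_inf => // _ [l [d [c [l0 Tdc ->]]]].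
    rewrite lerBlDr -lerBlDl; apply: lb_le_inf => // _ [l' [d' [c' [l'0 Tdc' ->]]]].
    have ll0 : 0 < l + l' by exact: addr_gt0.
    pose d'' := l / (l + l') *: d + (1 - l / (l + l')) *: d'.
    pose c'' := l / (l + l') * c + (1 - l / (l + l')) * c'.
    rewrite lerBlDl.
    apply: le_trans (ple _ ((l + l') * c'' + K * `|x + y - (l + l') *: d''|) _) _.
      exists (l + l'), d'', c''; split=> //.
      by apply: Tconv => //; rewrite divr_gt0//= ltr_pdivrMr// mul1r ltrDl.
    rewrite /d'' /c''.
    have -> : 1 - l / (l + l') = l' / (l + l') by field; rewrite gt_eqF.
    rewrite scalerDr !scalerA mulrDr !mulrA ![(l + l') * _]mulrC !mulfK ?gt_eqF//.
    have : K * `|x + y - (l *: d + l' *: d')| <= K * `|x - l *: d| + K * `|y - l' *: d'|.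
      by rewrite -mulrDr ler_wpM2l// opprD addrACA; exact: ler_normD.
    by lra.
  rewrite -ler_pdivrMl//; apply: lb_le_inf => // _ [l [d [c [l0 Tdc ->]]]].
  rewrite ler_pdivrMl//; apply: ple; exists (a * l), d, c; split=> //.
    exact: mulr_gt0.
  by rewrite -scalerA -scalerBr normrZ (gtr0_norm a0); ring.
have [u [ul up]] := sublinear_dominates_linear sp.
have pK z : p z <= K * `|z|.
  apply/ler_addgt0Pr => e e0.
  have c00 : 0 <= c0 by exact: T0.
  have c1 : 0 < c0 + 1 by rewrite ltr_wpDl.
  (* A small multiple of [(0, c0)] costs less than [e]; the denominator is [c0 + 1] because [c0] may
     vanish. *)
  apply: le_trans (ple _ (e / (c0 + 1) * c0 + K * `|z - (e / (c0 + 1)) *: 0|) _) _.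
    by exists (e / (c0 + 1)), 0, c0; split=> //; rewrite divr_gt0.
  rewrite scaler0 subr0 addrC lerD2l mulrAC ler_pdivrMr//.
  by rewrite ler_wpM2l ?ltW// ltrDl.
have uN z : u (- z) = - u z.
  have u0 : u 0 = 0 by have := ul 1 0 0; rewrite scale1r addr0 mul1r; lra.
  by have := ul (-1) z 0; rewrite scaleN1r addr0 u0 mulN1r addr0.
exists u; split.
  apply: (@bounded_is_dual _ _ _ K) => // z; rewrite ler_norml; apply/andP; split.
    by rewrite lerNl -uN -[`|z|]normrN; exact: le_trans (up _) (pK _).
  exact: le_trans (up _) (pK _).
move=> d c Tdc; apply: le_trans (up d) _; apply: ple; exists 1, d, c; split=> //.
by rewrite scale1r subrr normr0 mul1r mulr0 addr0.
Qed.

End Subgradient.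

(** * Conjugates of BC-functions *)

Section Conjugates.
Set Implicit Arguments. Unset Strict Implicit.
Variables (R : realType) (E : completeNormedModType R).
Implicit Types (k F f g : E -> (E -> R) -> \bar R) (s t u v : E -> R).

Lemma lee_fin_ub (a b : \bar R) :
  (forall M : R, (b <= M%:E)%E -> (a <= M%:E)%E) -> (a <= b)%E.
Proof.
case: b => [b||] ab; [exact: ab|exact: leey|].
case: a ab => [a||] ab //; last by have := ab 0 (leNye _).
by have := ab (a - 1) (leNye _); rewrite lee_fin lerBrDr gerDl ler10.
Qed.

(** The Fenchel-Young inequality on the epigraph: with a real [c] above [k x u], infinite values
    need no separate case. *)
Lemma conjat_ge k x u y v (c M : R) : is_dual u ->
  (conjat k y v <= M%:E)%E -> (k x u <= c%:E)%E -> bpair x u y v - c <= M.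
Proof.
move=> du kM kc; rewrite -lee_fin; apply: le_trans kM.
apply: le_trans (ereal_sup_ubound _); last by exists x, u.
by rewrite EFinB leeB.
Qed.

Lemma conjat_le k y v (M : R) : (forall x u, is_dual u -> k x u <> -oo%E) ->
  (forall x u (c : R), is_dual u -> (k x u <= c%:E)%E -> bpair x u y v - c <= M) ->
  (conjat k y v <= M%:E)%E.
Proof.
move=> kNy kM; apply: ge_ereal_sup => _ [x [u [du ->]]].
case kxu : (k x u) => [c||]; last by have := kNy _ _ du kxu.
  by rewrite -EFinB lee_fin; apply: kM => //; rewrite kxu.
exact: leNye.
Qed.

Lemma BC_notNy k x u : BC k -> is_dual u -> k x u <> -oo%E.
Proof. by move=> [[_ +] _] du; apply. Qed.

(* Compare [k] with [q] on the segment from a point of [Pq k] to an arbitrary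
   point of the epigraph and differentiate at the endpoint in [Pq k]. *)
Lemma Pq_conjat k : BC k -> Pq (conjat k) = Pq k.
Proof.
move=> BCk; have [_ [ck kq]] := BCk; apply/seteqP; split=> -[y v] [/= dv kyv].
  split=> //=; apply/eqP; rewrite eq_le (kq _ _ dv).1 andbT -kyv.
  exact: (kq _ _ dv).2.
split=> //=; apply/eqP; rewrite eq_le; apply/andP; split; last first.
  by apply: le_trans (kq _ _ dv).2; exact: (kq _ _ dv).1.
apply: conjat_le => [x u|x u c du kc]; first exact: BC_notNy.
rewrite leNgt; apply/negP => Hd.
(* The gap [d] is the assumed excess over [v y] and enters at first order in [l]; [B] dominates the
   second-order coefficient, so [l * B <= d / 2] leaves [q] strictly above the convexity bound. *)
pose B := `|bpair x u y v - v y - u x| + 1.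
pose d := bpair x u y v - c - v y.
have d0 : 0 < d by rewrite /d; lra.
have B0 : 0 < B by rewrite ltr_wpDl.
pose l := Num.min 2^-1 (d / 2 / B).
have l0 : 0 < l by rewrite lt_min invr_gt0 ltr0n/= !divr_gt0.
have l12 : l <= 2^-1 by rewrite ge_min lexx.
have l01 : 0 < l < 1 by rewrite l0/=; apply: le_lt_trans l12 _; lra.
have lB : l * B <= d / 2 by rewrite -ler_pdivlMr// ge_min lexx orbT.
have kyv' : (k y v <= (v y)%:E)%E by rewrite kyv.
have := convex_fun_le ck du dv l01 kc kyv'.
move/(le_trans (kq _ _ (dual_comb l (1 - l) du dv)).1).
have lin w : is_dual w -> w (l *: x + (1 - l) *: y) = l * w x + (1 - l) * w y.
  by move=> dw; rewrite dw.1 (dualZ _ _ dw).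
rewrite /q lee_fin (lin _ du) (lin _ dv).
have -> : l * (l * u x + (1 - l) * u y) + (1 - l) * (l * v x + (1 - l) * v y) =
    l * c + (1 - l) * v y + l * (d - l * (bpair x u y v - v y - u x)).
  by rewrite /d /bpair; ring.
rewrite gerDl pmulr_rle0// subr_le0.
have := ler_wpM2l (ltW l0) (ler_norm (bpair x u y v - v y - u x)).
by move: lB; rewrite /B mulrDr mulr1; lra.
Qed.

Lemma infsum_ub f g x s t : is_dual s -> is_dual t ->
  (infsum f g x (fun z => s z + t z)%R <= f x s + g x t)%E.
Proof. by move=> ds dt; apply: ereal_inf_lbound; exists s, t. Qed.

Lemma infsum_lt f g x u (c : R) :
  (forall x u, is_dual u -> f x u <> -oo%E) ->
  (forall x u, is_dual u -> g x u <> -oo%E) ->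
  (infsum f g x u < c%:E)%E ->
  exists s t (a b : R), [/\ is_dual s /\ is_dual t, u = (fun z => s z + t z),
    (f x s <= a%:E)%E, (g x t <= b%:E)%E & a + b < c].
Proof.
move=> fNy gNy /ereal_inf_lt[_ [s [t [ds [dt [stu ->]]]]]].
have := fNy x s ds; have := gNy x t dt.
case fE : (f x s) => [a||]; case gE : (g x t) => [b||] //= _ _.
rewrite -EFinD lte_fin => abc; exists s, t, a, b; split=> //.
- by apply/funext => z; rewrite stu.
- by rewrite fE.
- by rewrite gE.
Qed.

(** * The partial inf-convolution of two BC-functions *)

Section Sum.
Variables f g : E -> (E -> R) -> \bar R.
Hypotheses (BCf : BC f) (BCg : BC g).

Let fNy x u : is_dual u -> f x u <> -oo%E. Proof. exact: BC_notNy. Qed.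
Let gNy x u : is_dual u -> g x u <> -oo%E. Proof. exact: BC_notNy. Qed.
Let fq x u : is_dual u -> (q x u <= f x u)%E.
Proof. by move=> du; have [_ [_ /(_ x u du)[]]] := BCf. Qed.
Let gq x u : is_dual u -> (q x u <= g x u)%E.
Proof. by move=> du; have [_ [_ /(_ x u du)[]]] := BCg. Qed.
Let fconj x u : is_dual u -> (f x u <= conjat f x u)%E.
Proof. by move=> du; have [_ [_ /(_ x u du)[]]] := BCf. Qed.
Let gconj x u : is_dual u -> (g x u <= conjat g x u)%E.
Proof. by move=> du; have [_ [_ /(_ x u du)[]]] := BCg. Qed.

Lemma infsum_ge_q x u : (q x u <= infsum f g x u)%E.
Proof.
apply: le_ereal_inf_tmp => _ [s [t [ds [dt [stu ->]]]]].
by rewrite /q -stu EFinD; apply: leeD; [exact: fq|exact: gq].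
Qed.

Lemma infsum_notNy x u : infsum f g x u <> -oo%E.
Proof. by move=> hE; have := infsum_ge_q x u; rewrite hE /q leeNy_eq. Qed.

Lemma infsum_convex : convex_fun (infsum f g).
Proof.
move=> x u y v l du dv l01; have /andP[l0 l1] := l01.
have l1' : 0 < 1 - l by rewrite subr_gt0.
have := @infsum_notNy x u; have := @infsum_notNy y v.
case hx : (infsum f g x u) => [a||] //; case hy : (infsum f g y v) => [b||] // _ _.
- apply/lee_addgt0Pr => e e0.
  have hxe : (infsum f g x u < (a + e)%:E)%E by rewrite hx lte_fin ltrDl.
  have hye : (infsum f g y v < (b + e)%:E)%E by rewrite hy lte_fin ltrDl.
  have [s [t [c [d [[ds dt] -> fc gd cd]]]]] := infsum_lt (@fNy) (@gNy) hxe.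
  have [s' [t' [c' [d' [[ds' dt'] -> fc' gd' cd']]]]] := infsum_lt (@fNy) (@gNy) hye.
  have -> : (fun z => l * (s z + t z) + (1 - l) * (s' z + t' z)) =
    (fun z => (l * s z + (1 - l) * s' z) + (l * t z + (1 - l) * t' z)).
    by apply/funext => z; ring.
  apply: le_trans (infsum_ub _ _ _ (dual_comb _ _ ds ds') (dual_comb _ _ dt dt')) _.
  have F1 := convex_fun_le BCf.2.1 ds ds' l01 fc fc'.
  have G1 := convex_fun_le BCg.2.1 dt dt' l01 gd gd'.
  apply: le_trans (leeD F1 G1) _.
  rewrite -!EFinM -!EFinD lee_fin.
  have := ler_wpM2l (ltW l0) (ltW cd); have := ler_wpM2l (ltW l1') (ltW cd').
  by lra.
- by rewrite gt0_muley ?lte_fin// -EFinM addey// leey.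
- by rewrite gt0_muley ?lte_fin// -EFinM addye// leey.
- by rewrite !gt0_muley ?lte_fin// leey.
Qed.

(** The easy half of the conjugate formula: the parts of each splitting share the same point of [E],
    so the pairing is the sum of the pairings of the parts. *)
Lemma conjat_infsum_le x s t (a b : R) : is_dual s -> is_dual t ->
  (conjat f x s <= a%:E)%E -> (conjat g x t <= b%:E)%E ->
  (conjat (infsum f g) x (fun z => s z + t z)%R <= (a + b)%R%:E)%E.
Proof.
move=> ds dt fa gb; apply: conjat_le => [y u _|y u c du hc].
  exact: infsum_notNy.
apply/ler_addgt0Pr => e e0.
have [|s' [t' [c1 [c2 [[ds' dt'] -> fc gc cc]]]]] :=
    @infsum_lt f g y u (c + e) (@fNy) (@gNy).
  by apply: le_lt_trans hc _; rewrite lte_fin ltrDl.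
have := conjat_ge ds' fa fc; have := conjat_ge dt' gb gc.
by rewrite /bpair; lra.
Qed.

Hypotheses (lf : lsc f) (lg : lsc g).
Hypothesis closed_cone : closed_subspace (cone_diff (pi1dom f) (pi1dom g)).

Lemma conjat_infsum_exact y v (M : R) : is_dual v ->
  (conjat (infsum f g) y v <= M%:E)%E ->
  exists s t (a b : R), [/\ is_dual s /\ is_dual t, v = (fun z => s z + t z),
    (conjat f y s <= a%:E)%E, (conjat g y t <= b%:E)%E & a + b <= M].
Proof.
move=> dv hM; have [pf [cf _]] := BCf; have [pg [cg _]] := BCg.
(* [T] is the epigraph of the function [P] of the opening comment, up to attainment of the
   infimum. *)
pose T d e := exists a s b t (c1 c2 : R), [/\ is_dual s /\ is_dual t,
  (f a s <= c1%:E)%E, (g b t <= c2%:E)%E, d = a - b &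
  e = c1 - s y + (c2 - t y - v b + M)].
have [n [r [r0 ball]]] := sublevel_diff_ball pf cf lf pg cg lg closed_cone.
have [_ [S0 Slin]] := closed_cone.
have [C C0 vC] := dual_bounded dv.
have [u [du uT]] : exists u, is_dual u /\ forall d e, T d e -> u d <= e.
  (* The last constant bounds [P] on the ball of radius [r], where the data satisfy
     [|s y|, |t y| <= n |y|] and [|v b| <= C n]. *)
  apply: (@subgradient_at_zero _ E (cone_diff (pi1dom f) (pi1dom g)) T r
    (n + n * `|y| + (n + n * `|y| + C * n + M))) => //.
  - by move=> a x Sx; rewrite -[_ *: _]addr0; exact: Slin.
  - move=> d d' e e' l l01 [a [s [b [t [c1 [c2 [[ds dt] fc gc -> ->]]]]]]].
    move=> [a' [s' [b' [t' [c1' [c2' [[ds' dt'] fc' gc' -> ->]]]]]]].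
    exists (l *: a + (1 - l) *: a'), (fun z => l * s z + (1 - l) * s' z).
    exists (l *: b + (1 - l) *: b'), (fun z => l * t z + (1 - l) * t' z).
    exists (l * c1 + (1 - l) * c1'), (l * c2 + (1 - l) * c2'); split.
    + by split; exact: dual_comb.
    + exact: convex_fun_le.
    + exact: convex_fun_le.
    + by rewrite !scalerBr opprD addrACA.
    + by rewrite dv.1 (dualZ _ _ dv); ring.
  - move=> e [a [s [b [t [c1 [c2 [[ds dt] fc gc /esym/eqP]]]]]]].
    (* Over 0 the points [a] and [b] coincide, and nonnegativity is the Fenchel-Young inequality for
       [infsum f g] at [(a, s + t)]. *)
    rewrite subr_eq0 => /eqP ab ->; rewrite -ab in gc *.
    have hc : (infsum f g a (fun z => s z + t z)%R <= (c1 + c2)%R%:E)%E.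
      by apply: le_trans (infsum_ub _ _ _ ds dt) _; rewrite EFinD leeD.
    by have := conjat_ge (dual_add ds dt) hM hc; rewrite /bpair; lra.
  - move=> d e [a [s [b [t [c1 [c2 [[ds dt] fc gc -> _]]]]]]].
    have [n1 fa] := sublevel_exists ds fc; have [n2 gb] := sublevel_exists dt gc.
    exists 1; split=> //; exists a, b; rewrite scale1r.
    by split; [exact: sublevel_fin_num pf fa|split=> //; exact: sublevel_fin_num pg gb].
  - move=> w Sw wr.
    have [a [s [b [t [[an ds sn fn] [bn dt tn gn] wab]]]]] := ball w Sw wr.
    exists (n - s y + (n - t y - v b + M)); last by exists a, s, b, t, n, n.
    have sy := le_trans (ler_norm (- s y)) _; rewrite normrN in sy.
    have ty := le_trans (ler_norm (- t y)) _; rewrite normrN in ty.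
    have vb := le_trans (ler_norm (- v b)) _; rewrite normrN in vb.
    have := sy _ (sn y); have := ty _ (tn y).
    have := vb _ (le_trans (vC b) (ler_wpM2l C0 bn)).
    by lra.
(* Rearranged, the subgradient inequality bounds a term of the supremum [f^@(y, u)] plus one of
   [g^@(y, v - u)]; the two suprema can be taken one after the other. *)
have {}uT a s b t (c1 c2 : R) : is_dual s -> is_dual t -> (f a s <= c1%:E)%E ->
    (g b t <= c2%:E)%E -> u a + s y - c1 + (v b - u b + t y - c2) <= M.
  move=> ds dt fc gc.
  have := uT (a - b) (c1 - s y + (c2 - t y - v b + M)) _.
  rewrite (dualB _ _ du) => H.
  suff /H : T (a - b) (c1 - s y + (c2 - t y - v b + M)) by lra.
  by exists a, s, b, t, c1, c2.
(* One point where [g] is below [+oo] makes [f^@(y, u)] less than [+oo], and [f <= f^@] excludes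
   [-oo]. So it is a real [a], and [M - a] bounds [g^@(y, v - u)]. *)
have [[[x0 [t0 [dt0 gx0]]] _] _] := BCg.
have [c0 gc0] : exists c0 : R, (g x0 t0 <= c0%:E)%E.
  by case: (g x0 t0) gx0 => [c _||_]; [exists c|rewrite ltxx|exists 0; exact: leNye].
have fy : (conjat f y u <= (M - (v x0 - u x0 + t0 y - c0))%:E)%E.
  apply: conjat_le => [x s|x s c ds fc]; first exact: fNy.
  by have := uT _ _ _ _ _ _ ds dt0 fc gc0; rewrite /bpair; lra.
have : conjat f y u != -oo%E.
  apply/eqP => fE; have := fconj y du; rewrite fE leeNy_eq => /eqP.
  exact: fNy.
case fyE : (conjat f y u) fy => [a||] //= _ _.
exists u, (fun z => v z - u z), a, (M - a); split.
- by split=> //; exact: dual_sub.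
- by apply/funext => z; rewrite addrC subrK.
- by rewrite fyE.
- apply: conjat_le => [x t|b t c dt gc]; first exact: gNy.
  suff : (conjat f y u <= (M - (v b - u b + t y - c))%:E)%E.
    by rewrite fyE lee_fin /bpair; lra.
  apply: conjat_le => [x s|x s c1 ds fc]; first exact: fNy.
  by have := uT _ _ _ _ _ _ ds dt fc gc; rewrite /bpair; lra.
- by rewrite addrC subrK.
Qed.

Lemma infsum_BC : BC (infsum f g).
Proof.
split; [split|split].
(* As 0 lies in the cone and the factor [l] is positive, the two projected domains have a common
   point. *)
- have [_ [[l [l0 [a [b [[s [ds fs]] [[t [dt gt]] ab]]]]]] _]] := closed_cone.
  move/esym/eqP: ab; rewrite scaler_eq0 (gt_eqF l0) /= subr_eq0 => /eqP ab.
  exists a, (fun z => s z + t z); split; first exact: dual_add.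
  apply: le_lt_trans (infsum_ub _ _ _ ds dt) _; rewrite -ab in gt *.
  by rewrite lte_add_pinfty// ltey_eq ?fs ?gt.
- by move=> x u _; exact: infsum_notNy.
- exact: infsum_convex.
- move=> x u du; split; first exact: infsum_ge_q.
  apply: lee_fin_ub => M /(conjat_infsum_exact du)[s [t [a [b [[ds dt] -> fa gb ab]]]]].
  apply: le_trans (infsum_ub _ _ _ ds dt) _.
  apply: le_trans (leeD (fconj _ ds) (gconj _ dt)) _.
  apply: le_trans (leeD fa gb) _.
  by rewrite -EFinD lee_fin.
Qed.

(** An exact splitting has [s x <= f^@ <= a] and [t x <= g^@ <= b], whereas [a + b <= s x + t x];
    hence equality throughout. The converse combines the easy half of the conjugate formula with
    [h^@ >= h >= q]. *)
Lemma Pq_conjat_infsum : Pq (conjat (infsum f g)) =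
  [set p | exists s t, Pq (conjat f) (p.1, s) /\ Pq (conjat g) (p.1, t) /\
                       p.2 = (fun w => s w + t w)].
Proof.
apply/seteqP; split=> -[x u] /=.
  move=> [/= du hq]; have := lexx (conjat (infsum f g) x u).
  rewrite {2}hq => /(conjat_infsum_exact du)[s [t [a [b [[ds dt] uE fa gb ab]]]]].
  have sa : s x <= a.
    by rewrite -lee_fin; apply: le_trans (fq x ds) (le_trans (fconj _ ds) fa).
  have tb : t x <= b.
    by rewrite -lee_fin; apply: le_trans (gq x dt) (le_trans (gconj _ dt) gb).
  rewrite uE in ab; have sE : s x = a by lra.
  have tE : t x = b by lra.
  exists s, t; split; [|split=> //]; split=> //=; apply/eqP; rewrite eq_le.
    by rewrite {1}/q sE fa; apply: le_trans (fq x ds) (fconj _ ds).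
  by rewrite {1}/q tE gb; apply: le_trans (gq x dt) (gconj _ dt).
move=> [s [t [[/= ds fs] [[/= dt gt] ->]]]]; split=> /=; first exact: dual_add.
apply/eqP; rewrite eq_le; apply/andP; split.
  by apply: conjat_infsum_le => //; rewrite ?fs ?gt.
apply: le_trans (infsum_ge_q x _) _.
by have [_ [_ /(_ x _ (dual_add ds dt))[_]]] := infsum_BC.
Qed.

End Sum.
End Conjugates.

Theorem theorem5p3 (R : realType) (E : completeNormedModType R)
  (f g : E -> (E -> R) -> \bar R) :
  reflexive_space E -> (exists x : E, x != 0) ->
  proper_fun f -> convex_fun f -> lsc f -> BC f ->
  proper_fun g -> convex_fun g -> lsc g -> BC g ->
  closed_subspace (cone_diff (pi1dom f) (pi1dom g)) ->
  BC (infsum f g) /\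
  Pq (conjat (infsum f g)) =
    [set p | exists s t, Pq (conjat f) (p.1, s) /\ Pq (conjat g) (p.1, t) /\
                         p.2 = (fun w => s w + t w)] /\
  Pq (infsum f g) =
    [set p | exists s t, Pq f (p.1, s) /\ Pq g (p.1, t) /\
                         p.2 = (fun w => s w + t w)].
Proof.
move=> _ _ _ _ lf BCf _ _ lg BCg cl.
have BCh := infsum_BC BCf BCg lf lg cl.
split=> //; have := Pq_conjat_infsum BCf BCg lf lg cl.
(* The last claim is the preceding one read through [Pq k^@ = Pq k] for [f], [g] and their
   inf-convolution. *)
by rewrite !Pq_conjat.
Qed.
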